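(* The set $X^T$ of points of the Cayley Grassmannian $X$ fixed by the torus $T$ consists exactly of the points $[\widetilde e_{pqrs}]\in\mathbb P(\Lambda^4\mathbb O)$ where $pqrs$ is one of the following 44 index strings: $$0123,\ 0145,\ 0167,\ 2345,\ 2367,\ 4567,$$ $$0156,\ 2356,\ 1356,\ 0256,\ 1256,\ 0356,$$ $$1235,\ 1567,\ 0135,\ 3567,\ 0126,\ 2456,\ 0236,\ 0456,$$ $$1237,\ 1457,\ 0137,\ 3457,\ 0124,\ 2467,\ 0234,\ 0467,$$ $$0147,\ 2347,\ 1347,\ 0247,\ 1247,\ 0347,$$ $$1357,\ 1257,\ 0357,\ 1246,\ 0346,\ 0246,$$ $$1245,\ 1267,\ 0345,\ 0367.$$
   Context: **Octonions.** Let $\mathbb H$ be the complex quaternion algebra with $\mathbb C$-basis $1,\mathbf i,\mathbf j,\mathbf k$, $\mathbf i^2=\mathbf j^2=\mathbf k^2=\mathbf i\mathbf j\mathbf k=-1$, and conjugation $\overline{a+b\mathbf i+c\mathbf j+d\mathbf k}=a-b\mathbf i-c\mathbf j-d\mathbf k$. Let $\mathbb O=\mathbb H\oplus\mathbf l\,\mathbb H\cong\mathbb C^8$ be the complex octonion algebra with product $(a+\mathbf l b)(c+\mathbf l d)=(ac-d\bar b)+\mathbf l(cb+\bar a d)$ for $a,b,c,d\in\mathbb H$. Its standard basis is $e_0=1,e_1=\mathbf i,e_2=\mathbf j,e_3=\mathbf k,e_4=\mathbf l,e_5=\mathbf l\mathbf i,e_6=\mathbf l\mathbf j,e_7=\mathbf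 l\mathbf k$. $\mathrm{Re}$ is the projection onto $\mathbb C\cdot 1$, $\mathrm{Im}$ the projection onto $\langle e_1,\dots,e_7\rangle$, and $\bar u=\mathrm{Re}(u)-\mathrm{Im}(u)$. **Cayley Grassmannian.** Put $u\times v\times w=\frac12\big((u\bar v)w-(w\bar v)u\big)$ and $$x\times u\times v\times w=-\tfrac14\big[(x\times u\times v)\bar w-(w\times x\times u)\bar v+(v\times w\times x)\bar u-(u\times v\times w)\bar x\big].$$ A 4-dimensional subspace of $\mathbb O$ spanned by $x,u,v,w$ is a Cayley plane if $\mathrm{Im}(x\times u\times v\times w)=0$. The Cayley Grassmannian $X$ is the set of all Cayley planes, viewed inside $\mathrm{Gr}(4,\mathbb O)\subset\mathbb P(\Lambda^4\mathbb O)$ via the Plücker embedding. With $p_{ijkl}$ the Plücker coordinates with respect to $e_0,\dots,e_7$, $X$ is the subvariety of $\mathrm{Gr}(4,\mathbb O)$ cut out by - $-p_{0247}-p_{0256}+p_{0346}-p_{0357}+p_{1246}-p_{1257}+p_{1347}+p_{1356}=0$, - $p_{0147}+p_{0156}-p_{0345}-p_{0367}-p_{1245}-p_{1267}+p_{2347}+p_{2356}=0$, - $-p_{0146}+p_{0157}+p_{0245}+p_{0267}-p_{1345}-p_{1367}-p_{2346}+p_{2357}=0$, - $-p_{0127}+p_{0136}-p_{0235}+p_{0567}+p_{1234}-p_{1467}+p_{2457}-p_{3456}=0$, - $-p_{0126}-p_{0137}+p_{0234}-p_{0467}+p_{1235}-p_{1567}+p_{2456}+p_{3457}=0$, - $p_{0125}-p_{0134}-p_{0237}+p_{0457}+p_{1236}-p_{1456}-p_{2567}+p_{3467}=0$,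 - $p_{0124}+p_{0135}+p_{0236}-p_{0456}+p_{1237}-p_{1457}-p_{2467}-p_{3567}=0$. **Torus.** For $\lambda\in\mathbb C^*$ let $L_\lambda=\begin{pmatrix}\frac{\lambda+\lambda^{-1}}2&-i\frac{\lambda-\lambda^{-1}}2\\ i\frac{\lambda-\lambda^{-1}}2&\frac{\lambda+\lambda^{-1}}2\end{pmatrix}$. With respect to $e_0,\dots,e_7$, let $A_\lambda=L_\lambda\oplus L_\lambda\oplus L_\lambda\oplus L_\lambda$, $B_\mu=L_\mu\oplus L_{\mu^{-1}}\oplus I_4$, $C_\gamma=I_4\oplus L_\gamma\oplus L_{\gamma^{-1}}$, and $h(\lambda,\mu,\gamma)=A_\lambda B_\mu C_\gamma$. $T$ is the image of $h:(\mathbb C^* )^3\to \mathrm{SL}(8,\mathbb C)$; it is a maximal torus of $\mathrm{Spin}(7,\mathbb C)$, maps Cayley planes to Cayley planes, and so acts on $X$. **Eigenvectors.** $\widetilde e_0=e_0+ie_1$, $\widetilde e_1=e_0-ie_1$, $\widetilde e_2=e_2+ie_3$, $\widetilde e_3=e_2-ie_3$, $\widetilde e_4=e_4+ie_5$, $\widetilde e_5=e_4-ie_5$, $\widetilde e_6=e_6+ie_7$, $\widetilde e_7=e_6-ie_7$, where $i\in\mathbb C$ is the imaginary unit, and $\widetilde e_{pqrs}=\widetilde e_p\wedge\widetilde e_q\wedge\widetilde e_r\wedge\widetilde e_s$. *)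

(* Defs.v *)
From mathcomp Require Import all_boot all_order all_algebra.
From mathcomp Require Import complex.
From mathcomp Require Import boolp classical_sets reals.

Set Implicit Arguments.
Unset Strict Implicit.
Unset Printing Implicit Defensive.

Import GRing.Theory.
Local Open Scope ring_scope.
Local Open Scope complex_scope.
Local Open Scope classical_set_scope.

Section CayleyGrassmannian.
Context {R : realType}.
Local Notation C := R[i].

Definition quaternion := 'cV[C]_4.

Definition qcoord (x : quaternion) (m : nat) : C := x (inord m) 0.

(* Coordinates in the basis 1, i, j, k, with ij = k, jk = i, ki = j. *)
Definition qmul (x y : quaternion) : quaternion :=
  let a0 := qcoord x 0 in let a1 := qcoord x 1 in
  let a2 := qcoord x 2 in let a3 := qcoord x 3 in
  let b0 := qcoord y 0 in let b1 := qcoord y 1 in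
  let b2 := qcoord y 2 in let b3 := qcoord y 3 in
  \col_m [:: a0 * b0 - a1 * b1 - a2 * b2 - a3 * b3;
             a0 * b1 + a1 * b0 + a2 * b3 - a3 * b2;
             a0 * b2 - a1 * b3 + a2 * b0 + a3 * b1;
             a0 * b3 + a1 * b2 - a2 * b1 + a3 * b0]`_m.

Definition qconj (x : quaternion) : quaternion :=
  \col_m (if m == 0 then x m 0 else - x m 0).

Definition octonion := 'cV[C]_8.

(* a + l b; since l * x is the element with components 0 and x, the basis
   1, i, j, k, l, li, lj, lk is the standard basis of 'cV_(4 + 4). *)
Definition octo (a b : quaternion) : octonion := col_mx a b.
Definition ofst (x : octonion) : quaternion := @usubmx C 4 4 1 x.
Definition osnd (x : octonion) : quaternion := @dsubmx C 4 4 1 x.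

Definition omul (x y : octonion) : octonion :=
  let a := ofst x in let b := osnd x in
  let c := ofst y in let d := osnd y in
  octo (qmul a c - qmul d (qconj b)) (qmul c b + qmul (qconj a) d).

Definition obasis (k : nat) : octonion := \col_m (m == k :> nat)%:R.

Definition oRe (x : octonion) : octonion := x 0 0 *: obasis 0.
Definition oIm (x : octonion) : octonion := x - oRe x.
Definition oconj (x : octonion) : octonion := oRe x - oIm x.

Definition cross3 (u v w : octonion) : octonion :=
  2^-1 *: (omul (omul u (oconj v)) w - omul (omul w (oconj v)) u).

Definition cross4 (x u v w : octonion) : octonion :=
  - 4^-1 *: (omul (cross3 x u v) (oconj w) - omul (cross3 w x u) (oconj v)
             + omul (cross3 v w x) (oconj u) - omul (cross3 u v w) (oconj x)).

Definition cayley_plane (V : {vspace octonion}) : Prop :=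
  \dim V = 4%N /\
  exists x u v w : octonion,
    V = <<[:: x; u; v; w]>>%VS /\ oIm (cross4 x u v w) = 0.

Definition cayley_grassmannian : set {vspace octonion} :=
  [set V | cayley_plane V].

(* The fourth exterior power of the octonions, in the coordinates given by the
   basis e_i /\ e_j /\ e_k /\ e_l with i < j < k < l. *)
Definition four_subset := {S : {set 'I_8} | #|S| == 4%N}.
Definition Lambda4 := {ffun four_subset -> C^o}.

(* The coordinates of x /\ u /\ v /\ w are the 4 x 4 minors; [enum] lists the
   elements of a subset of 'I_8 in increasing order. *)
Definition wedge4 (x u v w : octonion) : Lambda4 :=
  [ffun S : four_subset =>
     \det (\matrix_(r < 4, s < 4)
             ([:: x; u; v; w]`_r) (nth ord0 (enum (val S)) s) 0)].

(* Points of the projective space of Lambda4 are lines in Lambda4. *)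
Definition plucker (V : {vspace octonion}) : {vspace Lambda4} :=
  let b m := (vbasis V)`_m in <[wedge4 (b 0%N) (b 1%N) (b 2%N) (b 3%N)]>%VS.

Definition torusL (t : C) : 'M[C]_2 :=
  let c := (t + t^-1) / 2 in
  let d := 'i%C * ((t - t^-1) / 2) in
  \matrix_(r, s) (nth [::] [:: [:: c; - d]; [:: d; c]] r)`_s.

Definition dsum m n (M : 'M[C]_m) (N : 'M[C]_n) : 'M[C]_(m + n) :=
  block_mx M 0 0 N.

Definition torusA (t : C) : 'M[C]_8 :=
  dsum (torusL t) (dsum (torusL t) (dsum (torusL t) (torusL t))).
Definition torusB (t : C) : 'M[C]_8 :=
  dsum (torusL t) (dsum (torusL t^-1) (1%:M : 'M_4)).
Definition torusC (t : C) : 'M[C]_8 :=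
  dsum (1%:M : 'M_4) (dsum (torusL t) (torusL t^-1)).

Definition torush (l m g : C) : 'M[C]_8 := torusA l *m torusB m *m torusC g.

Definition torus : set 'M[C]_8 :=
  [set M | exists l m g : C,
     [/\ l != 0, m != 0, g != 0 & M = torush l m g]].

Definition mx_act (M : 'M[C]_8) (V : {vspace octonion}) : {vspace octonion} :=
  (linfun (mulmx M : octonion -> octonion) @: V)%VS.

Definition torus_fixed : set {vspace octonion} :=
  [set V | cayley_grassmannian V /\ forall M, torus M -> mx_act M V = V].

Definition etilde (k : nat) : octonion :=
  [:: obasis 0 + 'i%C *: obasis 1; obasis 0 - 'i%C *: obasis 1;
      obasis 2 + 'i%C *: obasis 3; obasis 2 - 'i%C *: obasis 3;
      obasis 4 + 'i%C *: obasis 5; obasis 4 - 'i%C *: obasis 5;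
      obasis 6 + 'i%C *: obasis 7; obasis 6 - 'i%C *: obasis 7]`_k.

Definition etilde4 (I : nat * nat * nat * nat) : Lambda4 :=
  let: (p, q, r, s) := I in
  wedge4 (etilde p) (etilde q) (etilde r) (etilde s).

End CayleyGrassmannian.

Definition fixed_indices : seq (nat * nat * nat * nat) :=
  ([:: (0,1,2,3); (0,1,4,5); (0,1,6,7); (2,3,4,5); (2,3,6,7); (4,5,6,7);
       (0,1,5,6); (2,3,5,6); (1,3,5,6); (0,2,5,6); (1,2,5,6); (0,3,5,6);
       (1,2,3,5); (1,5,6,7); (0,1,3,5); (3,5,6,7);
       (0,1,2,6); (2,4,5,6); (0,2,3,6); (0,4,5,6);
       (1,2,3,7); (1,4,5,7); (0,1,3,7); (3,4,5,7);
       (0,1,2,4); (2,4,6,7); (0,2,3,4); (0,4,6,7);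
       (0,1,4,7); (2,3,4,7); (1,3,4,7); (0,2,4,7); (1,2,4,7); (0,3,4,7);
       (1,3,5,7); (1,2,5,7); (0,3,5,7); (1,2,4,6); (0,3,4,6); (0,2,4,6);
       (1,2,4,5); (1,2,6,7); (0,3,4,5); (0,3,6,7)])%N.

(* Main.v *)
Require Import Defs.
From mathcomp Require Import all_boot all_order all_algebra.
From mathcomp Require Import complex.
From mathcomp Require Import boolp classical_sets reals.
From mathcomp Require Import ring.

(** The eight octonions [etilde k] are eigenvectors of the torus, with the weights
    lm, 1/(lm), l/m, m/l, lg, 1/(lg), l/g, g/l in that order ([torush_etilde]). These
    are pairwise distinct characters, and a single well-chosen torus element already
    separates them ([weight_separated]); hence a subspace stable under the torus is
    spanned by the eigenvectors that it contains ([torus_stable_span]). The fixed points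
    of the Grassmannian of 4-planes are therefore the 70 coordinate planes of the
    eigenbasis, and it remains to decide which of them are Cayley planes.

    The Cayley condition asks for some spanning quadruple on which the imaginary part of
    the quadruple cross product vanishes. This map is linear and skew in its four
    arguments ([oIm_cross4_skew]), so the choice of the quadruple is immaterial
    ([skew_vanish_span]) and the eigenvectors themselves can be tested. Skewness of the
    quadruple product follows formally from that of the triple product, which is the
    polarized identity (u v') w + (v u') w = (w v') u + (w u') v, where v' is the
    conjugate of v; both members are 2 <u, v> w ([omul_conj_polar]).

    In the eigenbasis, rescaled by 1/2, the octonion product becomes Zorn's: a product
    of basis vectors is 0 or plus or minus a basis vector ([null_coord_omul]). This makes
    the polarized identity a small polynomial identity, and turns the 70 tests into
    integer arithmetic ([oIm_cross4_etilde]), with exactly the 44 listed strings passing.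
    Finally the Pluecker line of a plane can be computed from any of its bases, as the
    minors of two bases differ by a determinant ([plucker_span]). *)

Import GRing.Theory Num.Theory.

Local Open Scope ring_scope.
Local Open Scope classical_set_scope.

(** * Skew quadrilinear maps *)

Section SkewQuadrilinear.
Context {K : numFieldType} {V : vectType K} {W : lmodType K}.
Implicit Types (f : V -> V -> V -> V -> W) (x y u v w : V) (X : seq V).

(** Linearity in the first slot and antisymmetry under adjacent transpositions
    force linearity in the other slots. *)
Definition skew_quadrilinear f :=
  [/\ forall a x y u v w, f (a *: x + y) u v w = a *: f x u v w + f y u v w,
      forall x u v w, f u x v w = - f x u v w,
      forall x u v w, f x v u w = - f x u v w &
      forall x u v w, f x u w v = - f x u v w].

Lemma linear_vanish_span (g : V -> W) X :
    (forall a x y, g (a *: x + y) = a *: g x + g y) ->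
    {in X, forall x, g x = 0} -> {in <<X>>%VS, forall y, g y = 0}.
Proof.
move=> glin gX y yX; rewrite (coord_span (X := in_tuple X) yX).
have g0 : g 0 = 0.
  by have := glin 1 0 0; rewrite !scale1r addr0 => /eqP; rewrite -subr_eq subrr => /eqP.
elim/big_rec: _ => // i z _ gz.
by rewrite glin gz addr0 gX ?scaler0 // mem_nth.
Qed.

(** A skew form depends on its arguments only through their exterior product, so
    whether it vanishes on a spanning quadruple is a property of the subspace.
    This makes the Cayley condition testable on any chosen basis. By
    multilinearity only quadruples of the four given vectors matter: those with a
    repetition vanish, the others are permutations of the given one. *)
Lemma skew_vanish_span f x u v w :
    skew_quadrilinear f -> f x u v w = 0 ->
  forall y1 y2 y3 y4,
    y1 \in <<[:: x; u; v; w]>>%VS -> y2 \in <<[:: x; u; v; w]>>%VS ->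
    y3 \in <<[:: x; u; v; w]>>%VS -> y4 \in <<[:: x; u; v; w]>>%VS ->
  f y1 y2 y3 y4 = 0.
Proof.
case=> lin1 s12 s23 s34 f0.
have lin2 a y z t1 t2 t3 :
    f t1 (a *: y + z) t2 t3 = a *: f t1 y t2 t3 + f t1 z t2 t3.
  by rewrite s12 lin1 opprD -scalerN -!s12.
have lin3 a y z t1 t2 t3 :
    f t1 t2 (a *: y + z) t3 = a *: f t1 t2 y t3 + f t1 t2 z t3.
  by rewrite s23 lin2 opprD -scalerN -!s23.
have lin4 a y z t1 t2 t3 :
    f t1 t2 t3 (a *: y + z) = a *: f t1 t2 t3 y + f t1 t2 t3 z.
  by rewrite s34 lin3 opprD -scalerN -!s34.
have opp0 (t : W) : t = - t -> t = 0.
  move=> /eqP; rewrite -addr_eq0 -mulr2n -scaler_nat scaler_eq0.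
  by rewrite (pnatr_eq0 K 2) => /eqP.
have e12 a b c : f a a b c = 0 by apply/opp0/s12.
have e23 a b c : f b a a c = 0 by apply/opp0/s23.
have e34 a b c : f b c a a = 0 by apply/opp0/s34.
have e13 a b c : f a b a c = 0 by rewrite s12 e23 oppr0.
have e24 a b c : f b a c a = 0 by rewrite s23 e34 oppr0.
have e14 a b c : f a b c a = 0 by rewrite s12 e24 oppr0.
pose X := [:: x; u; v; w].
have on_basis a b c d : a \in X -> b \in X -> c \in X -> d \in X -> f a b c d = 0.
  rewrite /X !inE.
  (* repeated arguments vanish; the rest are bubble-sorted into x, u, v, w *)
  do 4![case/or4P=> /eqP->];
    rewrite ?(e12, e23, e34, e13, e24, e14) //;
    rewrite ?(s12 x u, s12 x v, s12 x w, s12 u v, s12 u w, s12 v w,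
               s23 _ x u, s23 _ x v, s23 _ x w,
               s23 _ u v, s23 _ u w, s23 _ v w,
               s34 _ _ x u, s34 _ _ x v, s34 _ _ x w,
               s34 _ _ u v, s34 _ _ u w, s34 _ _ v w);
    by rewrite f0 ?oppr0.
move=> y1 y2 y3 y4 y1X y2X y3X y4X.
apply: (linear_vanish_span (fun t => f t _ _ _)) y1X => [|a aX] //.
apply: (linear_vanish_span (fun t => f _ t _ _)) y2X => [|b bX] //.
apply: (linear_vanish_span (fun t => f _ _ t _)) y3X => [|c cX] //.
apply: (linear_vanish_span (fun t => f _ _ _ t)) y4X => [|d dX] //.
exact: on_basis.
Qed.
End SkewQuadrilinear.

(** * The octonion product in null coordinates *)

Section NullCoordinates.
Context {K : pzRingType}.
Implicit Types a b c d : seq K.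

(** Octonion product in the basis of the halved torus eigenvectors. These are null
    for the norm, and in such a basis the product of two basis vectors is zero or
    plus or minus a basis vector, so the eight coordinates have four terms each
    and integer coefficients. This is Zorn's model of the octonions. *)
Definition null_mul a b : seq K :=
  [:: a`_0 * b`_0 - a`_2 * b`_3 - a`_5 * b`_4 - a`_7 * b`_6;
      a`_1 * b`_1 - a`_3 * b`_2 - a`_4 * b`_5 - a`_6 * b`_7;
      a`_0 * b`_2 + a`_2 * b`_1 - a`_4 * b`_6 + a`_6 * b`_4;
      a`_1 * b`_3 + a`_3 * b`_0 - a`_5 * b`_7 + a`_7 * b`_5;
      a`_1 * b`_4 + a`_2 * b`_7 + a`_4 * b`_0 - a`_7 * b`_2;
      a`_0 * b`_5 + a`_3 * b`_6 + a`_5 * b`_1 - a`_6 * b`_3;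
      a`_1 * b`_6 - a`_2 * b`_5 + a`_5 * b`_2 + a`_6 * b`_0;
      a`_0 * b`_7 - a`_3 * b`_4 + a`_4 * b`_3 + a`_7 * b`_1].

Definition null_conj a : seq K :=
  [:: a`_1; a`_0; - a`_2; - a`_3; - a`_4; - a`_5; - a`_6; - a`_7].

Definition null_sub a b : seq K := mkseq (fun k => a`_k - b`_k) 8.

(** This is twice the triple cross product: the factor 1/2 is left out so that the
    formula makes sense over the integers. *)
Definition null_cross3 a b c : seq K :=
  null_sub (null_mul (null_mul a (null_conj b)) c)
           (null_mul (null_mul c (null_conj b)) a).

(** This is -8 times the quadruple cross product, again to clear denominators. *)
Definition null_cross4 a b c d : seq K :=
  null_sub (null_sub (null_mul (null_cross3 a b c) (null_conj d))
                     (null_mul (null_cross3 d a b) (null_conj c)))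
           (null_sub (null_mul (null_cross3 b c d) (null_conj a))
                     (null_mul (null_cross3 c d a) (null_conj b))).

(** These are the scalars: the first two halved eigenvectors sum to 1, and the other
    six are imaginary. *)
Definition null_real a :=
  [&& a`_0 == a`_1, a`_2 == 0, a`_3 == 0, a`_4 == 0, a`_5 == 0, a`_6 == 0
    & a`_7 == 0].

End NullCoordinates.

Lemma null_mul_linearl (K : comPzRingType) (c : K) (a a' b d : seq K) k :
    (k < 8)%N -> (forall j, d`_j = c * a`_j + a'`_j) ->
  (null_mul d b)`_k = c * (null_mul a b)`_k + (null_mul a' b)`_k.
Proof.
by case: k => [|[|[|[|[|[|[|[|k]]]]]]]] //= _ dE; rewrite !dE; ring.
Qed.

Lemma null_mul_linearr (K : comPzRingType) (c : K) (a b b' d : seq K) k :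
    (k < 8)%N -> (forall j, d`_j = c * b`_j + b'`_j) ->
  (null_mul a d)`_k = c * (null_mul a b)`_k + (null_mul a b')`_k.
Proof.
by case: k => [|[|[|[|[|[|[|[|k]]]]]]]] //= _ dE; rewrite !dE; ring.
Qed.

(** Both sides equal 2 <u, v> w: on the left because u v' + v u' is a scalar, v' being
    the conjugate of v, and on the right by the linearized alternative law. In null
    coordinates this is a cubic polynomial identity, small enough to be checked
    directly. *)
Lemma null_mul_conj_polar (K : comPzRingType) (u v w : seq K) k : (k < 8)%N ->
  (null_mul (null_mul u (null_conj v)) w)`_k
    + (null_mul (null_mul v (null_conj u)) w)`_k =
  (null_mul (null_mul w (null_conj v)) u)`_k
    + (null_mul (null_mul w (null_conj u)) v)`_k.
Proof.
by case: k => [|[|[|[|[|[|[|[|k]]]]]]]] //= _; ring.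
Qed.

(** * Cross products from a polarized composition law *)

Section CrossProducts.
Context (K : numFieldType) (O : vectType K) (mul : O -> O -> O) (conj : O -> O).
Context (mulDl : forall a x y z, mul (a *: x + y) z = a *: mul x z + mul y z).
Context (mulDr : forall a x y z, mul z (a *: x + y) = a *: mul z x + mul z y).
Context (conjD : forall a x y, conj (a *: x + y) = a *: conj x + conj y).
Context (conj_polar : forall u v w,
  mul (mul u (conj v)) w + mul (mul v (conj u)) w =
  mul (mul w (conj v)) u + mul (mul w (conj u)) v).
Implicit Types (a : K) (x y z u v w : O).

Definition triple u v w : O :=
  2^-1 *: (mul (mul u (conj v)) w - mul (mul w (conj v)) u).

Definition quadruple x u v w : O :=
  - 4^-1 *: (mul (triple x u v) (conj w) - mul (triple w x u) (conj v)
             + mul (triple v w x) (conj u) - mul (triple u v w) (conj x)).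

Lemma triple_linear a x y v w :
  triple (a *: x + y) v w = a *: triple x v w + triple y v w.
Proof.
rewrite /triple !(mulDl, mulDr) opprD addrACA scalerDr -scalerBr.
by rewrite !scalerA [2^-1 * a]mulrC.
Qed.

Lemma triple_swap13 u v w : triple w v u = - triple u v w.
Proof. by rewrite /triple -scalerN opprB. Qed.

(** This is where the composition law enters: the sum of the two triple products is
    half the difference of the two members of [conj_polar]. *)
Lemma triple_swap12 u v w : triple v u w = - triple u v w.
Proof.
apply/eqP; rewrite -addr_eq0 /triple -scalerDr addrACA -opprD.
by rewrite conj_polar subrr scaler0.
Qed.

Lemma triple_swap23 u v w : triple u w v = - triple u v w.
Proof. by rewrite triple_swap13 triple_swap12 triple_swap13 !opprK. Qed.

Lemma triple_cycle u v w : triple w u v = triple u v w.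
Proof. by rewrite triple_swap12 triple_swap23 opprK. Qed.

Lemma mulZl a x y : mul (a *: x) y = a *: mul x y.
Proof.
have := mulDl a x 0 y; have := mulDl (-1) 0 0 y.
by rewrite scaler0 !addr0 scaleN1r addNr => ->; rewrite addr0.
Qed.

Lemma mulNl x y : mul (- x) y = - mul x y.
Proof. by rewrite -[- x]scaleN1r mulZl scaleN1r. Qed.

Lemma quadruple_linear a x y u v w :
  quadruple (a *: x + y) u v w = a *: quadruple x u v w + quadruple y u v w.
Proof.
have t2 z1 z2 : triple z1 (a *: x + y) z2 = a *: triple z1 x z2 + triple z1 y z2.
  by rewrite !(triple_swap12 _ z1) triple_linear opprD scalerN.
have t3 z1 z2 : triple z1 z2 (a *: x + y) = a *: triple z1 z2 x + triple z1 z2 y.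
  by rewrite !(triple_swap13 _ _ z1) triple_linear opprD scalerN.
rewrite /quadruple triple_linear t2 t3 conjD mulDr !mulDl.
set k := - 4^-1; rewrite scalerA [a * k]mulrC -scalerA -scalerDr; congr (_ *: _).
have linB (p1 q1 p2 q2 : O) :
    a *: p1 + q1 - (a *: p2 + q2) = a *: (p1 - p2) + (q1 - q2).
  by rewrite opprD addrACA scalerBr.
by rewrite !linB addrACA -scalerDr linB.
Qed.

Lemma quadruple_scaled x u v w :
  (- 8) *: quadruple x u v w =
  mul (2 *: triple x u v) (conj w) - mul (2 *: triple w x u) (conj v)
  - (mul (2 *: triple u v w) (conj x) - mul (2 *: triple v w x) (conj u)).
Proof.
have -> : - 8 = 2 * - 4 :> K by ring.
have mul2l y z : mul (2 *: y) z = 2 *: mul y z := mulZl 2 y z.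
rewrite !mul2l -!scalerBr -scalerA; congr (_ *: _).
by rewrite /quadruple scalerA mulrNN mulfV ?pnatr_eq0 // scale1r opprB addrA.
Qed.

(** With its cyclic rotations undone, the quadruple product is the alternating sum
    over which of the four ordered arguments is conjugated. Its antisymmetry then
    reduces to that of the triple product. *)
Lemma quadrupleE x u v w :
  quadruple x u v w = - 4^-1 *:
    (mul (triple x u v) (conj w) - mul (triple x u w) (conj v)
     + (mul (triple x v w) (conj u) - mul (triple u v w) (conj x))).
Proof. by rewrite /quadruple (triple_cycle x u w) -(triple_cycle v w x) addrA. Qed.

Lemma quadruple_skew : skew_quadrilinear quadruple.
Proof.
split=> [||x u v w|x u v w]; first exact: quadruple_linear.
- move=> x u v w; rewrite !quadrupleE -scalerN; congr (_ *: _).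
  rewrite (triple_swap12 x u v) (triple_swap12 x u w) !mulNl !opprD !opprK.
  by congr (_ + _); rewrite addrC.
- rewrite !quadrupleE -scalerN; congr (_ *: _).
  rewrite (triple_swap23 x u v) (triple_swap12 u v w) !mulNl !opprD !opprK.
  by rewrite addrACA.
- rewrite !quadrupleE -scalerN; congr (_ *: _).
  rewrite (triple_swap23 x v w) (triple_swap23 u v w) !mulNl !opprD !opprK.
  by congr (_ + _); rewrite addrC.
Qed.
End CrossProducts.

(** * Octonions and their null coordinates *)

Section Octonions.
Context {R : realType}.
Local Notation C := R[i].
Local Notation O := (@octonion R).
Implicit Types (a : C) (x y z u v w : O).

Definition ocoord x (k : nat) : C := x (inord k) 0.

Lemma octonionP x y :
  (forall k, (k < 8)%N -> ocoord x k = ocoord y k) -> x = y.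
Proof.
move=> eq_xy; apply/colP => k.
by have := eq_xy k (ltn_ord k); rewrite /ocoord inord_val.
Qed.

Lemma ocoord_linear a x y k : ocoord (a *: x + y) k = a * ocoord x k + ocoord y k.
Proof. by rewrite /ocoord !mxE. Qed.

Lemma ocoordD x y k : ocoord (x + y) k = ocoord x k + ocoord y k.
Proof. by rewrite /ocoord !mxE. Qed.

Lemma ocoordN x k : ocoord (- x) k = - ocoord x k.
Proof. by rewrite /ocoord !mxE. Qed.

Lemma ocoordZ a x k : ocoord (a *: x) k = a * ocoord x k.
Proof. by rewrite /ocoord !mxE. Qed.

Lemma qcoord_ofst x k : (k < 4)%N -> qcoord (ofst x) k = ocoord x k.
Proof.
move=> k4; rewrite /qcoord /ofst /ocoord mxE; congr (x _ _).
by apply/val_inj; rewrite /= !inordK // (leq_trans k4).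
Qed.

Lemma qcoord_osnd x k : (k < 4)%N -> qcoord (osnd x) k = ocoord x (4 + k).
Proof.
move=> k4; rewrite /qcoord /osnd /ocoord mxE; congr (x _ _).
by apply/val_inj; rewrite /= !inordK // -[8%N]/(4 + 4)%N ltn_add2l.
Qed.

Lemma ocoord_octo (p q : quaternion) k : (k < 8)%N ->
  ocoord (octo p q) k = if (k < 4)%N then qcoord p k else qcoord q (k - 4).
Proof.
move=> k8; rewrite /ocoord /octo /qcoord mxE; case: splitP => j /=.
  by rewrite inordK // => ->; rewrite ltn_ord inord_val.
by rewrite inordK // => ->; rewrite addKn inord_val ltnNge leq_addr.
Qed.

Lemma qcoordD (p q : @quaternion R) k : qcoord (p + q) k = qcoord p k + qcoord q k.
Proof. by rewrite /qcoord mxE. Qed.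

Lemma qcoordN (p : @quaternion R) k : qcoord (- p) k = - qcoord p k.
Proof. by rewrite /qcoord mxE. Qed.

Lemma qcoord_qmul (p q : @quaternion R) k : (k < 4)%N ->
  qcoord (qmul p q) k =
   [:: qcoord p 0 * qcoord q 0 - qcoord p 1 * qcoord q 1
       - qcoord p 2 * qcoord q 2 - qcoord p 3 * qcoord q 3;
       qcoord p 0 * qcoord q 1 + qcoord p 1 * qcoord q 0
       + qcoord p 2 * qcoord q 3 - qcoord p 3 * qcoord q 2;
       qcoord p 0 * qcoord q 2 - qcoord p 1 * qcoord q 3
       + qcoord p 2 * qcoord q 0 + qcoord p 3 * qcoord q 1;
       qcoord p 0 * qcoord q 3 + qcoord p 1 * qcoord q 2
       - qcoord p 2 * qcoord q 1 + qcoord p 3 * qcoord q 0]`_k.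
Proof. by move=> k4; rewrite {1}/qcoord mxE inordK. Qed.

Lemma qcoord_qconj (p : @quaternion R) k : (k < 4)%N ->
  qcoord (qconj p) k = if k == 0%N then qcoord p k else - qcoord p k.
Proof.
by move=> k4; rewrite /qcoord mxE -val_eqE /= inordK.
Qed.

Lemma ocoord_omul x y k : (k < 8)%N ->
  let a := ocoord x in let b := ocoord y in
  ocoord (omul x y) k =
  [:: a 0 * b 0 - a 1 * b 1 - a 2 * b 2 - a 3 * b 3
        - a 4 * b 4 - a 5 * b 5 - a 6 * b 6 - a 7 * b 7;
      a 0 * b 1 + a 1 * b 0 + a 2 * b 3 - a 3 * b 2
        - a 4 * b 5 + a 5 * b 4 - a 6 * b 7 + a 7 * b 6;
      a 0 * b 2 - a 1 * b 3 + a 2 * b 0 + a 3 * b 1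
        - a 4 * b 6 + a 5 * b 7 + a 6 * b 4 - a 7 * b 5;
      a 0 * b 3 + a 1 * b 2 - a 2 * b 1 + a 3 * b 0
        - a 4 * b 7 - a 5 * b 6 + a 6 * b 5 + a 7 * b 4;
      a 0 * b 4 + a 1 * b 5 + a 2 * b 6 + a 3 * b 7
        + a 4 * b 0 - a 5 * b 1 - a 6 * b 2 - a 7 * b 3;
      a 0 * b 5 - a 1 * b 4 - a 2 * b 7 + a 3 * b 6
        + a 4 * b 1 + a 5 * b 0 - a 6 * b 3 + a 7 * b 2;
      a 0 * b 6 + a 1 * b 7 - a 2 * b 4 - a 3 * b 5
        + a 4 * b 2 + a 5 * b 3 + a 6 * b 0 - a 7 * b 1;
      a 0 * b 7 - a 1 * b 6 + a 2 * b 5 - a 3 * b 4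
        + a 4 * b 3 - a 5 * b 2 + a 6 * b 1 + a 7 * b 0]`_k.
Proof.
move=> k8 a b; rewrite /omul ocoord_octo //.
case: k k8 => [|[|[|[|[|[|[|[|k]]]]]]]] //= _;
  rewrite !(qcoordD, qcoordN, qcoord_qmul) //= !qcoord_qconj //=
          !(qcoord_ofst, qcoord_osnd) // ?addn0 -/a -/b /=; ring.
Qed.

Lemma ocoord_oRe x k : (k < 8)%N ->
  ocoord (oRe x) k = if k == 0%N then ocoord x 0 else 0.
Proof.
move=> k8; rewrite ocoordZ [ocoord (obasis 0) k]/ocoord mxE inordK //.
rewrite {1}/ocoord (_ : inord 0 = 0) ; last by apply/val_inj; rewrite /= inordK.
by case: eqP => _; rewrite ?mulr1 ?mulr0.
Qed.

Lemma ocoord_oIm x k : (k < 8)%N ->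
  ocoord (oIm x) k = if k == 0%N then 0 else ocoord x k.
Proof.
move=> k8; rewrite ocoordD ocoordN ocoord_oRe //.
by case: eqP => [->|_]; rewrite ?subrr ?subr0.
Qed.

Lemma ocoord_oconj x k : (k < 8)%N ->
  ocoord (oconj x) k = if k == 0%N then ocoord x k else - ocoord x k.
Proof.
move=> k8; rewrite ocoordD ocoordN ocoord_oRe // ocoord_oIm //.
by case: eqP => [->|_]; rewrite ?subr0 ?sub0r.
Qed.

(** Halves are cleared here: x is half the sum of its null coordinates times the
    torus eigenvectors. *)
Definition null_coord x : seq C :=
  [:: ocoord x 0 - 'i%C * ocoord x 1; ocoord x 0 + 'i%C * ocoord x 1;
      ocoord x 2 - 'i%C * ocoord x 3; ocoord x 2 + 'i%C * ocoord x 3;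
      ocoord x 4 - 'i%C * ocoord x 5; ocoord x 4 + 'i%C * ocoord x 5;
      ocoord x 6 - 'i%C * ocoord x 7; ocoord x 6 + 'i%C * ocoord x 7].

Lemma null_coord_linear a x y k :
  (null_coord (a *: x + y))`_k = a * (null_coord x)`_k + (null_coord y)`_k.
Proof.
case: k => [|[|[|[|[|[|[|[|k]]]]]]]] /=; rewrite ?ocoord_linear; try ring.
by rewrite !nth_nil mulr0 addr0.
Qed.

Lemma null_coord_omul x y :
  null_coord (omul x y) = null_mul (null_coord x) (null_coord y).
Proof.
have i2 : 'i%C ^+ 2 = -1 :> C by rewrite sqr_i.
rewrite /null_coord /null_mul !ocoord_omul //=.
do 8![congr (_ :: _); first by ring: i2].
Qed.

Lemma null_coord_oconj x : null_coord (oconj x) = null_conj (null_coord x).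
Proof.
by rewrite /null_coord /null_conj !ocoord_oconj //=; do 8![congr (_ :: _); first by ring].
Qed.

Lemma ocoordE x n : n = null_coord x ->
  [:: ocoord x 0; ocoord x 1; ocoord x 2; ocoord x 3;
      ocoord x 4; ocoord x 5; ocoord x 6; ocoord x 7] =
  [:: (n`_0 + n`_1) / 2; 'i%C * (n`_0 - n`_1) / 2;
      (n`_2 + n`_3) / 2; 'i%C * (n`_2 - n`_3) / 2;
      (n`_4 + n`_5) / 2; 'i%C * (n`_4 - n`_5) / 2;
      (n`_6 + n`_7) / 2; 'i%C * (n`_6 - n`_7) / 2].
Proof.
have n2 : 2 != 0 :> C by rewrite pnatr_eq0.
have i2 : 'i%C ^+ 2 = -1 :> C by rewrite sqr_i.
have re (a b : C) : a = (a - 'i%C * b + (a + 'i%C * b)) / 2 by field.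
have im (a b : C) : b = 'i%C * (a - 'i%C * b - (a + 'i%C * b)) / 2 by field: i2.
by move=> ->; do 4![congr (_ :: _); [exact: re | congr (_ :: _); first exact: im]].
Qed.

Lemma null_coord_inj : injective null_coord.
Proof.
move=> x y eq_xy; have := ocoordE y _ eq_xy; rewrite -(ocoordE x _ erefl) => -[*].
by apply: octonionP => -[|[|[|[|[|[|[|[|k]]]]]]]].
Qed.

Lemma ocoord_obasis m k : (k < 8)%N -> ocoord (obasis m) k = (k == m)%:R.
Proof. by move=> k8; rewrite /ocoord mxE inordK. Qed.

Lemma null_coord_etilde k : (k < 8)%N ->
  null_coord (etilde k) = [seq (j == k)%:R *+ 2 | j <- iota 0 8].
Proof.
have i2 : 'i%C * 'i%C = -1 :> C by rewrite -expr2 sqr_i.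
case: k => [|[|[|[|[|[|[|[|k]]]]]]]] //= _;
  rewrite /null_coord /etilde /= ?(ocoordD, ocoordN, ocoordZ) !ocoord_obasis //=;
  by rewrite !(mulr0, mulr1, mulrN, addr0, add0r, subr0, sub0r, oppr0, i2,
               opprK, subrr, addNr, mul0rn).
Qed.

Lemma etilde_expansion x :
  x = \sum_(k < 8) ((null_coord x)`_k / 2) *: etilde k.
Proof.
apply: null_coord_inj; apply: (@eq_from_nth _ 0) => // j j8.
have -> (c : 'I_8 -> C) :
    (null_coord (\sum_(k < 8) c k *: etilde k))`_j =
    \sum_(k < 8) c k * (null_coord (etilde k))`_j.
  elim/big_rec2: _ => [|k s t _ <-]; last by rewrite null_coord_linear.
  have := null_coord_linear 0 0 0 j; rewrite scale0r addr0 mul0r add0r.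
  have := null_coord_linear 1 0 0 j; rewrite scale1r addr0 mul1r => /eqP.
  by rewrite -subr_eq subrr => /eqP.
rewrite (bigD1 (Ordinal j8)) //= big1 => [|k kj].
  by rewrite null_coord_etilde // addr0 (nth_map 0%N) ?nth_iota ?size_iota //
   add0n eqxx mulrVK ?unitfE ?pnatr_eq0.
by rewrite null_coord_etilde // (nth_map 0%N) ?nth_iota ?size_iota //
   add0n eq_sym (negbTE (kj : (k : nat) != j)) mul0rn mulr0.
Qed.

Lemma oIm_eq0 x : (oIm x == 0) = null_real (null_coord x).
Proof.
apply/eqP/idP => [Im0|].
  have im k : (k < 8)%N -> k != 0%N -> ocoord x k = 0.
    move=> k8 k0; have := ocoord_oIm x k k8.
    by rewrite Im0 (negbTE k0) => <-; rewrite /ocoord mxE.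
  rewrite /null_real /null_coord /= !(im 1, im 2, im 3, im 4, im 5, im 6, im 7)%N //.
  by rewrite !mulr0 !subr0 !addr0 !eqxx.
move: (null_coord x) (ocoordE x _ erefl) => n xE.
case/and5P=> n01 n2 n3 n4 /and3P[n5 n6 n7]; move: xE.
rewrite (eqP n01) (eqP n2) (eqP n3) (eqP n4) (eqP n5) (eqP n6) (eqP n7).
rewrite !(subrr, addr0, mulr0, mul0r) => -[_ *].
apply: octonionP => k k8; rewrite ocoord_oIm // [RHS]mxE.
by case: k k8 => [|[|[|[|[|[|[|[|k]]]]]]]].
Qed.
End Octonions.

(** * Cayley planes spanned by torus eigenvectors *)

Section Cross.
Context {R : realType}.
Local Notation C := R[i].
Local Notation O := (@octonion R).
Implicit Types (a : C) (x y z u v w : O).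

Lemma omul_linearl a x y z : omul (a *: x + y) z = a *: omul x z + omul y z.
Proof.
apply: null_coord_inj; apply: (@eq_from_nth _ 0) => // k k8.
rewrite null_coord_linear !null_coord_omul; apply: null_mul_linearl => // j.
exact: null_coord_linear.
Qed.

Lemma omul_linearr a x y z : omul z (a *: x + y) = a *: omul z x + omul z y.
Proof.
apply: null_coord_inj; apply: (@eq_from_nth _ 0) => // k k8.
rewrite null_coord_linear !null_coord_omul; apply: null_mul_linearr => // j.
exact: null_coord_linear.
Qed.

Lemma oconj_linear a x y : oconj (a *: x + y) = a *: oconj x + oconj y.
Proof.
apply: octonionP => k k8; rewrite ocoord_linear !ocoord_oconj // ocoord_linear.
by case: eqP => // _; ring.
Qed.

Lemma null_coordD x y k : (null_coord (x + y))`_k = (null_coord x)`_k + (null_coord y)`_k.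
Proof. by have := null_coord_linear 1 x y k; rewrite scale1r mul1r. Qed.

Lemma null_coordB x y : null_coord (x - y) = null_sub (null_coord x) (null_coord y).
Proof.
apply: (@eq_from_nth _ 0) => // k k8; rewrite nth_mkseq //.
by rewrite addrC -scaleN1r null_coord_linear mulN1r addrC.
Qed.

Lemma omul_conj_polar u v w :
  omul (omul u (oconj v)) w + omul (omul v (oconj u)) w =
  omul (omul w (oconj v)) u + omul (omul w (oconj u)) v.
Proof.
apply: null_coord_inj; apply: (@eq_from_nth _ 0) => // k k8.
have {}k8 : (k < 8)%N := k8.
rewrite null_coordD [RHS]null_coordD.
(* from here on only the transport of the operations to null coordinates matters *)
move: (@null_coord_omul R) (@null_coord_oconj R).
move: (@omul R) (@oconj R) (@null_coord R) => m c n nM nC.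
by rewrite !(nM, nC); apply: null_mul_conj_polar.
Qed.

Lemma cross4_skew : skew_quadrilinear (@cross4 R).
Proof.
exact (quadruple_skew _ _ (@omul R) (@oconj R)
         omul_linearl omul_linearr oconj_linear omul_conj_polar).
Qed.

Lemma oIm_linear a x y : oIm (a *: x + y) = a *: oIm x + oIm y.
Proof.
apply: octonionP => k k8; rewrite ocoord_linear !ocoord_oIm // ocoord_linear.
by case: eqP => // _; ring.
Qed.

Lemma oImN x : oIm (- x) = - oIm x.
Proof.
apply: octonionP => k k8; rewrite ocoordN !ocoord_oIm // ocoordN.
by case: eqP => // _; rewrite oppr0.
Qed.

Lemma oIm_cross4_skew : skew_quadrilinear (fun x u v w : O => oIm (cross4 x u v w)).
Proof.
case: cross4_skew => lin s12 s23 s34.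
split=> [a x y u v w|x u v w|x u v w|x u v w].
- by rewrite lin; apply: oIm_linear.
- by rewrite s12; apply: oImN.
- by rewrite s23; apply: oImN.
- by rewrite s34; apply: oImN.
Qed.

Definition cast_seq (s : seq int) : seq C := [seq n%:~R | n <- s].

Lemma nth_cast_seq s j : (cast_seq s)`_j = (s`_j)%:~R.
Proof. by elim: s j => [|n s IH] [|j] //=; rewrite ?nth_nil. Qed.

Lemma cast_null_mul s t : cast_seq (null_mul s t) = null_mul (cast_seq s) (cast_seq t).
Proof. by rewrite /null_mul !nth_cast_seq /= !(rmorphB, rmorphD, rmorphM). Qed.

Lemma cast_null_conj s : cast_seq (null_conj s) = null_conj (cast_seq s).
Proof. by rewrite /null_conj !nth_cast_seq /= !rmorphN. Qed.

Lemma cast_null_sub s t : cast_seq (null_sub s t) = null_sub (cast_seq s) (cast_seq t).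
Proof.
apply: (@eq_from_nth _ 0) => // k k8.
by rewrite nth_cast_seq !nth_mkseq // !nth_cast_seq rmorphB.
Qed.

Lemma null_real_cast s : null_real (cast_seq s) = null_real s.
Proof. by rewrite /null_real !nth_cast_seq eqr_int !intr_eq0. Qed.

Lemma null_coord_double_cross3 u v w (a b c : seq int) :
  null_coord u = cast_seq a -> null_coord v = cast_seq b -> null_coord w = cast_seq c ->
  null_coord (2 *: cross3 u v w) = cast_seq (null_cross3 a b c).
Proof.
rewrite /cross3 scalerA mulfV ?pnatr_eq0 // scale1r null_coordB.
move: (@null_coord_omul R) (@null_coord_oconj R).
move: (@omul R) (@oconj R) (@null_coord R) => m f n nM nC ua vb wc.
by rewrite !nM !nC ua vb wc -!cast_null_conj -!cast_null_mul -cast_null_sub.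
Qed.

Lemma cross4_scaled x u v w :
  (- 8) *: cross4 x u v w =
  omul (2 *: cross3 x u v) (oconj w) - omul (2 *: cross3 w x u) (oconj v)
  - (omul (2 *: cross3 u v w) (oconj x) - omul (2 *: cross3 v w x) (oconj u)).
Proof. exact (quadruple_scaled _ _ (@omul R) (@oconj R) omul_linearl x u v w). Qed.

Lemma null_coord_cross4_scaled x u v w (a b c d : seq int) :
  null_coord x = cast_seq a -> null_coord u = cast_seq b ->
  null_coord v = cast_seq c -> null_coord w = cast_seq d ->
  null_coord ((- 8) *: cross4 x u v w) = cast_seq (null_cross4 a b c d).
Proof.
move=> xa ub vc wd; rewrite cross4_scaled.
move: (null_coord_double_cross3 _ _ _ _ _ _ xa ub vc)
      (null_coord_double_cross3 _ _ _ _ _ _ wd xa ub)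
      (null_coord_double_cross3 _ _ _ _ _ _ ub vc wd)
      (null_coord_double_cross3 _ _ _ _ _ _ vc wd xa).
move: (2 *: cross3 x u v) (2 *: cross3 w x u) (2 *: cross3 u v w) (2 *: cross3 v w x).
move=> x1 x2 x3 x4.
move: null_coordB (@null_coord_omul R) (@null_coord_oconj R) xa ub vc wd.
move: (@omul R) (@oconj R) (@null_coord R) => m f n nB nM nC xa ub vc wd e1 e2 e3 e4.
rewrite !nB !nM !nC xa ub vc wd e1 e2 e3 e4.
by rewrite -!cast_null_conj -!cast_null_mul -!cast_null_sub.
Qed.

Lemma oIm_cross4_eq0 x u v w (a b c d : seq int) :
  null_coord x = cast_seq a -> null_coord u = cast_seq b ->
  null_coord v = cast_seq c -> null_coord w = cast_seq d ->
  (oIm (cross4 x u v w) == 0) = null_real (null_cross4 a b c d).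
Proof.
move=> xa ub vc wd.
rewrite -null_real_cast -(null_coord_cross4_scaled _ _ _ _ _ _ _ _ xa ub vc wd) -oIm_eq0.
have -> (y : O) : oIm (- 8 *: y) = - 8 *: oIm y.
  have := oIm_linear (- 8) y 0; have := oIm_linear (-1) 0 0.
  by rewrite scaler0 !addr0 scaleN1r addNr => ->; rewrite addr0.
by rewrite scaler_eq0 oppr_eq0 pnatr_eq0.
Qed.

(** The entry is 2, and not 1, because null coordinates refer to the halved
    eigenvectors. *)
Definition null_etilde k : seq int := [seq (j == k)%:R *+ 2 | j <- iota 0 8].

(** All null coordinates of the eigenvectors being integers, the Cayley condition for
    the 70 coordinate 4-planes is decided by integer arithmetic. *)
Lemma oIm_cross4_etilde p q r s : (p < q < r)%N -> (r < s < 8)%N ->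
  (oIm (cross4 (etilde p) (etilde q) (etilde r) (etilde s)) == 0 :> O) =
  ((p, q, r, s) \in fixed_indices).
Proof.
move=> /andP[pq qr] /andP[rs s8].
have r8 := ltn_trans rs s8; have q8 := ltn_trans qr r8.
have p8 := ltn_trans pq q8.
have castE k : (k < 8)%N -> null_coord (etilde k) = cast_seq (null_etilde k).
  move=> k8; rewrite null_coord_etilde // /cast_seq /null_etilde -map_comp.
  by apply: eq_map => j /=; rewrite rmorphMn /= natz.
rewrite (oIm_cross4_eq0 _ _ _ _ _ _ _ _
           (castE _ p8) (castE _ q8) (castE _ r8) (castE _ s8)).
have /allP/(_ p) : all (fun p => all (fun q => all (fun r => all (fun s =>
    (p < q < r)%N && (r < s)%N ==>
    (null_real (null_cross4 (null_etilde p) (null_etilde q)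
                            (null_etilde r) (null_etilde s)) ==
     ((p, q, r, s) \in fixed_indices)))
  (iota 0 8)) (iota 0 8)) (iota 0 8)) (iota 0 8) by vm_compute.
rewrite mem_iota => /(_ p8)/allP/(_ q); rewrite mem_iota => /(_ q8).
move=> /allP/(_ r); rewrite mem_iota => /(_ r8)/allP/(_ s).
by rewrite mem_iota pq qr rs => /(_ s8)/eqP.
Qed.
End Cross.

(** * The torus action *)

Section Torus.
Context {R : realType}.
Local Notation C := R[i].
Local Notation O := (@octonion R).

(** The torus acts on each of the four planes spanned by the pairs of basis vectors
    numbered 2j and 2j+1, through the same rotation group. *)
Definition planes (a b c d : 'cV[C]_2) : O := col_mx a (col_mx b (col_mx c d)).

Definition plane (x : O) (j : nat) : 'cV[C]_2 := \col_r ocoord x (2 * j + r).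

Lemma planesE (x : O) : x = planes (plane x 0) (plane x 1) (plane x 2) (plane x 3).
Proof.
have planeE k (i : 'I_8) : i = k :> nat -> x i 0 = ocoord x k.
  by move=> ij; rewrite /ocoord; congr (x _ _); apply/val_inj; rewrite /= inordK -ij.
rewrite -[LHS](@vsubmxK C 2 6 1 x); apply: f_equal2.
  by apply/colP => r; rewrite !mxE; apply: planeE.
rewrite -[LHS](@vsubmxK C 2 4 1); apply: f_equal2.
  by apply/colP => r; rewrite !mxE; apply: planeE.
rewrite -[LHS](@vsubmxK C 2 2 1); apply: f_equal2.
  by apply/colP => r; rewrite !mxE; apply: planeE.
by apply/colP => r; rewrite !mxE; apply: planeE.
Qed.

Lemma dsumM m n (M : 'M[C]_m) (N : 'M[C]_n) (a : 'cV[C]_m) (b : 'cV[C]_n) :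
  dsum M N *m col_mx a b = col_mx (M *m a) (N *m b).
Proof. by rewrite /dsum mul_block_col !mul0mx addr0 add0r. Qed.

Lemma torushM (l m g : C) (a b c d : 'cV[C]_2) :
  torush l m g *m planes a b c d =
  planes (torusL l *m (torusL m *m a)) (torusL l *m (torusL m^-1 *m b))
         (torusL l *m (torusL g *m c)) (torusL l *m (torusL g^-1 *m d)).
Proof.
rewrite /torush -!mulmxA /planes.
have -> : torusC g *m col_mx a (col_mx b (col_mx c d)) =
    planes a b (torusL g *m c) (torusL g^-1 *m d).
  (* this factor splits as 4 + (2 + 2), so the four planes are regrouped *)
  rewrite col_mxA castmx_id.
  apply: etrans (dsumM 4 4 1%:M (dsum (torusL g) (torusL g^-1))
                       (col_mx a b) (col_mx c d)) _.
  apply: etrans (f_equal2 (@col_mx C 4 4 1) (mul1mx _)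
                          (dsumM 2 2 (torusL g) (torusL g^-1) c d)) _.
  by rewrite /planes [RHS]col_mxA castmx_id.
have -> (c' d' : 'cV[C]_2) : torusB m *m planes a b c' d' =
    planes (torusL m *m a) (torusL m^-1 *m b) c' d'.
  apply: etrans (dsumM 2 6 (torusL m) (dsum (torusL m^-1) 1%:M) a
                       (col_mx b (col_mx c' d'))) _.
  apply: f_equal2 => //; apply: etrans (dsumM 2 4 _ _ _ _) _.
  by rewrite mul1mx.
apply: etrans (dsumM 2 6 _ _ _ _) _; apply: f_equal2 => //.
apply: etrans (dsumM 2 4 _ _ _ _) _; apply: f_equal2 => //.
exact (dsumM 2 2 _ _ _ _).
Qed.

Definition null_vector (s : bool) : 'cV[C]_2 := \col_r [:: 1; (-1) ^+ s * 'i%C]`_r.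

Lemma torusL_null t s : t != 0 ->
  torusL t *m null_vector s = (if s then t^-1 else t) *: null_vector s.
Proof.
move=> t0; have i2 : 'i%C ^+ 2 = -1 :> C by rewrite sqr_i.
apply/colP => -[[|[|k]] k2] //; rewrite !mxE !big_ord_recl big_ord0 !mxE /=;
  by case: s; rewrite ?expr1 ?expr0; field: i2.
Qed.

Lemma plane_etilde k j : (k < 8)%N -> (j < 4)%N ->
  plane (etilde k) j = if k./2 == j then null_vector (odd k) else 0.
Proof.
move=> k8 j4; apply/colP => r; rewrite mxE.
case: k k8 => [|[|[|[|[|[|[|[|k]]]]]]]] //= _;
  rewrite ?(ocoordD, ocoordN, ocoordZ) !ocoord_obasis //;
  by case: j j4 => [|[|[|[|j]]]] //= _; case: r => -[|[|r]] r2 //; rewrite !mxE //=;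
     rewrite !(mulr0, mulr1, mul1r, expr1, mulN1r, addr0, add0r, subr0, sub0r,
               oppr0).
Qed.

Definition weight (l m g : C) k : C :=
  let t := l * [:: m; m^-1; g; g^-1]`_(k./2) in if odd k then t^-1 else t.

Lemma planesZ t a b c d :
  t *: planes a b c d = planes (t *: a) (t *: b) (t *: c) (t *: d).
Proof. by rewrite /planes -!scale_col_mx. Qed.

Lemma torush_etilde l m g k : l != 0 -> m != 0 -> g != 0 -> (k < 8)%N ->
  torush l m g *m etilde k = weight l m g k *: etilde k.
Proof.
move=> l0 m0 g0 k8; rewrite (planesE (etilde k)) torushM planesZ !plane_etilde //.
have mi0 : m^-1 != 0 by rewrite invr_eq0.
have gi0 : g^-1 != 0 by rewrite invr_eq0.
have LL t s : t != 0 -> torusL l *m (torusL t *m null_vector s) =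
    (if s then (l * t)^-1 else l * t) *: null_vector s.
  move=> t0; rewrite torusL_null // -scalemxAr torusL_null // scalerA.
  by case: s => //; rewrite ?invfM // mulrC.
rewrite /weight; case: k k8 => [|[|[|[|[|[|[|[|k]]]]]]]] //= _;
  by rewrite !mulmx0 !scaler0 LL.
Qed.
End Torus.

(** * Fixed subspaces and their Pluecker lines *)

Lemma increasing_string p q r s : (p < q < r)%N -> (r < s < 8)%N ->
  sorted ltn [:: p; q; r; s] /\ {in [:: p; q; r; s], forall k, (k < 8)%N}.
Proof.
move=> /andP[pq qr] /andP[rs s8]; split; first by rewrite /= pq qr rs.
have r8 := ltn_trans rs s8; have q8 := ltn_trans qr r8.
by apply/allP; rewrite /= s8 r8 q8 (ltn_trans pq q8).
Qed.

(** Applying f - d_j for every j different from k to a vector of V kills all its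
    components but the k-th, which is only multiplied by a nonzero scalar. *)
Lemma stable_eigenvector (K : fieldType) (W : vectType K) n (f : 'End(W))
    (e : 'I_n -> W) (d c : 'I_n -> K) (V : {vspace W}) :
    injective d -> (forall k, f (e k) = d k *: e k) -> (f @: V <= V)%VS ->
    \sum_k c k *: e k \in V -> forall k, c k != 0 -> e k \in V.
Proof.
move=> dI fe fV vV k ck0.
have killed (s : seq 'I_n) :
    \sum_i (c i * \prod_(j <- s) (d i - d j)) *: e i \in V.
  elim: s => [|j s IH].
    by under eq_bigr do rewrite big_nil mulr1.
  have := memvB (subvP fV _ (memv_img f IH)) (memvZ (d j) IH).
  rewrite linear_sum scaler_sumr -sumrB; congr (_ \in V); apply: eq_bigr => i _.
  by rewrite linearZ /= fe !scalerA -scalerBl big_cons; congr (_ *: _); ring.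
have := killed [seq j <- enum 'I_n | j != k].
rewrite (bigD1 k) //= [X in _ + X]big1 => [|i ik]; last first.
  have i_in : i \in [seq j <- enum 'I_n | j != k] by rewrite mem_filter ik mem_enum.
  by rewrite (big_rem i i_in) /= subrr mul0r mulr0 scale0r.
rewrite addr0 rpredZeq mulf_eq0 (negbTE ck0) /= prodf_seq_eq0.
case/orP=> // /hasP[j]; rewrite mem_filter => /andP[jk _] /=.
by rewrite subr_eq0 => /eqP/dI kj; rewrite kj eqxx in jk.
Qed.

Section FixedPoints.
Context {R : realType}.
Local Notation C := R[i].
Local Notation O := (@octonion R).
Implicit Types (x y u v w : O) (V : {vspace O}).

(** The minors of a product of a 4 x 4 matrix with a 4 x 8 matrix are those of the
    second factor times the determinant of the first. *)
Lemma wedge4_span x u v w y1 y2 y3 y4 :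
  {subset [:: y1; y2; y3; y4] <= <<[:: x; u; v; w]>>%VS} ->
  wedge4 y1 y2 y3 y4 \in <[wedge4 x u v w]>%VS.
Proof.
pose X := [tuple x; u; v; w]; pose Y := [:: y1; y2; y3; y4] => YX.
pose M := \matrix_(r < 4, j < 4) coord X j Y`_r.
apply/vlineP; exists (\det M); apply/ffunP => S.
rewrite !ffunE -[RHS]det_mulmx; congr (\det _); apply/matrixP => r s.
have /coord_span yE : Y`_r \in <<X>>%VS by apply/YX/mem_nth.
rewrite !mxE {1}yE summxE; apply: eq_bigr => j _.
by rewrite !mxE.
Qed.

Lemma wedge4_line x u v w y1 y2 y3 y4 :
  <<[:: x; u; v; w]>>%VS = <<[:: y1; y2; y3; y4]>>%VS ->
  <[wedge4 x u v w]>%VS = <[wedge4 y1 y2 y3 y4]>%VS.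
Proof.
move=> eqXY; apply/eqP; rewrite eqEsubv; apply/andP; split; rewrite -memvE.
  by apply: wedge4_span; rewrite -eqXY; apply: memv_span.
by apply: wedge4_span; rewrite eqXY; apply: memv_span.
Qed.

(** The Pluecker line is defined through one chosen basis of the subspace; any other
    basis differs from it by an invertible matrix and gives the same line. *)
Lemma plucker_span x u v w :
  \dim <<[:: x; u; v; w]>> = 4%N ->
  plucker <<[:: x; u; v; w]>>%VS = <[wedge4 x u v w]>%VS.
Proof.
move=> dim4; rewrite /plucker; set V := <<_>>%VS in dim4 *; apply: wedge4_line.
rewrite -/V -[RHS](span_basis (vbasisP V)); congr <<_>>%VS.
move: (vbasis V); rewrite dim4 => b; case: b => -[|b0 [|b1 [|b2 [|b3 [|]]]]] //.
Qed.

Lemma etilde_free : free [seq @etilde R k | k <- iota 0 8].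
Proof.
rewrite /free size_map size_iota.
have -> : <<[seq @etilde R k | k <- iota 0 8]>>%VS = fullv.
  apply/eqP; rewrite eqEsubv subvf; apply/subvP => x _; rewrite (etilde_expansion x).
  apply: rpred_sum => k _; apply/rpredZ/memv_span/map_f.
  by rewrite mem_iota ltn_ord.
by rewrite dimvf dim_matrix.
Qed.

(** Index strings are increasing, so they are filters of the full list of indices and
    freeness is inherited from the eigenbasis. *)
Lemma etilde_sub_free (I : seq nat) : sorted ltn I -> {in I, forall k, (k < 8)%N} ->
  free [seq @etilde R k | k <- I].
Proof.
move=> sI I8.
have {1}-> : I = [seq k <- iota 0 8 | k \in I].
  apply: (irr_sorted_eq ltn_trans ltnn) => // [|k].
    exact/(sorted_filter ltn_trans)/iota_ltn_sorted.
  by rewrite mem_filter mem_iota; case: (boolP (k \in I)) => // /I8.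
have := etilde_free.
elim: (iota 0 8) => //= k J IH; rewrite free_cons => /andP[kJ /IH freeJ].
case: ifP => //= _; rewrite free_cons freeJ andbT; apply: contra kJ.
apply/subvP/sub_span => x /mapP[j]; rewrite mem_filter => /andP[_ jJ] ->.
exact: map_f.
Qed.

(** One torus element already has eight distinct eigenvalues. For the parameters
    8, 2, 4 the eigenvalues are powers of 2, namely 16, 1/16, 4, 1/4, 32, 1/32, 2, 1/2;
    scaled by 32 they become distinct natural numbers. *)
Lemma weight_separated : injective (fun k : 'I_8 => weight (8 : C) 2 4 k).
Proof.
pose n32 := [:: 512; 2; 128; 8; 1024; 1; 64; 16]%N.
have n0 n : n.+1%:R != 0 :> C by rewrite pnatr_eq0.
have wE k : (k < 8)%N -> weight (8 : C) 2 4 k = (nth 0%N n32 k)%:R / 32.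
  by case: k => [|[|[|[|[|[|[|[|k]]]]]]]] // _; rewrite /weight /=; field.
move=> [j j8] [k k8] /=; rewrite !wE // => /(mulIf _) => /(_ (invr_neq0 (n0 31))).
move=> /eqP; rewrite eqr_nat nth_uniq // => /eqP jk; exact/val_inj.
Qed.

Lemma mx_actE (M : 'M[C]_8) x : linfun (mulmx M : O -> O) x = M *m x.
Proof. by rewrite lfunE. Qed.

Lemma torus_stable_span V : (forall M, torus M -> mx_act M V = V) ->
  V = <<[seq etilde k | k <- [seq k <- iota 0 8 | etilde k \in V]]>>%VS.
Proof.
have n0 n : n.+1%:R != 0 :> C by rewrite pnatr_eq0.
move=> fixV; apply/eqP; rewrite eqEsubv; apply/andP; split; last first.
  by apply/span_subvP => x /mapP[k]; rewrite mem_filter => /andP[kV _] ->.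
apply/subvP => x xV; rewrite (etilde_expansion x); apply: rpred_sum => k _.
have [->|ck0] := eqVneq ((null_coord x)`_k / 2) 0; first by rewrite scale0r mem0v.
apply/rpredZ/memv_span/map_f; rewrite mem_filter mem_iota /= ltn_ord andbT.
pose M := torush (8 : C) 2 4.
have TM : torus M by exists 8, 2, 4; split; rewrite ?n0.
apply: (stable_eigenvector _ _ _ (linfun (mulmx M : O -> O)) (fun k => etilde k)
          (fun k => weight 8 2 4 k) (fun k => (null_coord x)`_k / 2) V
          weight_separated) ck0.
- by move=> j; rewrite mx_actE torush_etilde ?n0.
- by have := fixV M TM; rewrite /mx_act => ->.
- by rewrite -etilde_expansion.
Qed.

Lemma etilde_span_fixed (I : seq nat) (M : 'M[C]_8) :
    {in I, forall k, (k < 8)%N} -> torus M ->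
  mx_act M <<[seq etilde k | k <- I]>> = <<[seq etilde k | k <- I]>>%VS.
Proof.
move=> I8 [l [m [g [l0 m0 g0 ->]]]].
have w0 k : (k < 8)%N -> weight l m g k != 0.
  rewrite /weight; set t := l * _ => k8.
  suff t0 : t != 0 by case: odd; rewrite ?invr_eq0.
  rewrite mulf_neq0 //.
  by case: k k8 {t} => [|[|[|[|[|[|[|[|k]]]]]]]] //= _; rewrite ?invr_eq0.
rewrite /mx_act limg_span -map_comp; apply/eqP; rewrite eqEsubv; apply/andP; split.
  apply/span_subvP => x /mapP[k kI ->] /=; rewrite mx_actE torush_etilde ?I8 //.
  by apply/memvZ/memv_span/map_f.
apply/span_subvP => x /mapP[k kI ->].
rewrite -[etilde k]scale1r -(mulVf (w0 k (I8 k kI))) -scalerA -torush_etilde ?I8 //.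
rewrite -mx_actE; apply/memvZ/memv_span/mapP; exists k => //.
Qed.

Lemma dim_etilde_span (I : seq nat) : sorted ltn I -> {in I, forall k, (k < 8)%N} ->
  \dim <<[seq @etilde R k | k <- I]>> = size I.
Proof.
move=> sI I8; apply/eqP; rewrite -(size_map (@etilde R) I).
exact: etilde_sub_free.
Qed.

Lemma cayley_etilde p q r s : (p < q < r)%N -> (r < s < 8)%N ->
  @cayley_plane R <<[seq etilde k | k <- [:: p; q; r; s]]>>%VS <->
  (p, q, r, s) \in fixed_indices.
Proof.
move=> pqr rs8; have [sI I8] := increasing_string _ _ _ _ pqr rs8.
rewrite -(oIm_cross4_etilde (R := R) p q r s pqr rs8); split=> [[_]|/eqP Im0].
  case=> x [u [v [w [spanE Im0]]]]; apply/eqP.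
  have mem k : k \in [:: p; q; r; s] -> @etilde R k \in <<[:: x; u; v; w]>>%VS.
    by move=> kI; rewrite -spanE; apply/memv_span/map_f.
  apply: (skew_vanish_span _ x u v w oIm_cross4_skew Im0); apply: mem;
    by rewrite !inE eqxx ?orbT.
split; last by exists (etilde p), (etilde q), (etilde r), (etilde s).
exact: (dim_etilde_span [:: p; q; r; s]).
Qed.
End FixedPoints.

Lemma fixed_indices_increasing p q r s :
  (p, q, r, s) \in fixed_indices -> [/\ p < q < r & r < s < 8]%N.
Proof.
move=> I; apply/andP; pose ok (I : nat * nat * nat * nat) :=
  let: (p, q, r, s) := I in ((p < q < r) && (r < s < 8))%N.
by apply: (allP (_ : all ok fixed_indices) _ I).
Qed.

Theorem theorem6p2 (R : realType) :
  (@plucker R) @` torus_fixed =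
  [set L | exists2 I, I \in fixed_indices & L = <[etilde4 I]>%VS].
Proof.
have pluckerE p q r s : (p < q < r)%N -> (r < s < 8)%N ->
    plucker <<[seq @etilde R k | k <- [:: p; q; r; s]]>>%VS =
    <[etilde4 (p, q, r, s)]>%VS.
  move=> pqr rs8; have [sI I8] := increasing_string _ _ _ _ pqr rs8.
  exact/plucker_span/(dim_etilde_span [:: p; q; r; s]).
apply/seteqP; split=> [_ [V [cayV fixV] <-]|_ [[[[p q] r] s] I ->]] /=.
  pose S := [seq k <- iota 0 8 | @etilde R k \in V].
  have VE : V = <<[seq etilde k | k <- S]>>%VS by apply: torus_stable_span.
  have S_sorted : sorted ltn S by apply/(sorted_filter ltn_trans)/iota_ltn_sorted.
  have S8 : {in S, forall k, (k < 8)%N}.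
    by move=> k; rewrite mem_filter mem_iota => /andP[_].
  have sizeS : size S = 4%N.
    by rewrite -(dim_etilde_span (R := R) _ S_sorted S8) -VE; case: cayV.
  move: S sizeS S_sorted S8 VE => -[|p [|q [|r [|s [|]]]]] //= _.
  move=> /and4P[pq qr rs _] S8 VE.
  have s8 : (s < 8)%N by apply: S8; rewrite !inE eqxx !orbT.
  have pqr : (p < q < r)%N by rewrite pq.
  have rs8 : (r < s < 8)%N by rewrite rs.
  exists (p, q, r, s); last by rewrite VE; apply: pluckerE.
  by apply/(cayley_etilde (R := R) p q r s pqr rs8); rewrite /= -VE.
have [pqr rs8] := fixed_indices_increasing _ _ _ _ I.
exists <<[seq @etilde R k | k <- [:: p; q; r; s]]>>%VS; last exact: pluckerE.
split=> [|M TM]; first exact/(cayley_etilde _ _ _ _ pqr rs8).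
by apply: etilde_span_fixed TM; case: (increasing_string _ _ _ _ pqr rs8).
Qed.
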